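(* Let $k\ge2$ and let $H_2$ be a graph with vertex set $[3]^k$. If $H_2$ is $k$-minimal, then $$\frac{3^k+1}{2}\le|E(H_2)|\le k\cdot(3^{k-1}+2^{k-1}).$$
   Context: All graphs are finite and simple. $[k]=\{1,\dots,k\}$; $[3]^k$ is the set of vectors $x=(x_{(1)},\dots,x_{(k)})$ with entries in $\{1,2,3\}$. For a graph $F$ and $S\subseteq V(F)$, $\mathcal E(F,S)$ is the set of all $S$-coverings in $F$, i.e. sets $E\subseteq E(F)$ such that every vertex of $S$ is incident to at least one edge of $E$. $\overline K_{[k]}$ is the edgeless graph on $[k]$. For a graph $H_2$ on $[3]^k$, $\overline K_{[k]}\circ H_2$ is the graph on the disjoint union $[k]\sqcup[3]^k$ with edge set $E(H_2)\cup\{\{i,x\}: i\in[k],\ x\in[3]^k,\ x_{(i)}=1\}$. For a set $E$ of 2-subsets of $[3]^k$, $span(E)$ is the graph with vertex set $[3]^k$ and edge set $E$. For $i\in[k]$ and $j\in\{1,2,3\}$ let $[3]^k_i(j)=\{x\in[3]^k:x_{(i)}=j\}$. Let $C^k_i$ be the bipartite graph with parts $[3]^k_i(1)$ and $[3]^k_i(2)$, in which $x\in[3]^k_i(1)$ and $y\in[3]^k_i(2)$ are adjacent iff $|x_{(t)}-y_{(t)}|\le1$ for all $t\in[k]\setminus\{i\}$; let $D^k_i$ be the bipartite graph with parts $[3]^k_i(2)$ and $[3]^k_i(3)$, in which $x\in[3]^k_i(2)$ and $y\in[3]^k_i(3)$ are adjacent iff $|x_{(t)}-y_{(t)}|\le1$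 for all $t\in[k]\setminus\{i\}$. Let $S^k_i=\{x\in[3]^k: x_{(i)}=3,\ x_{(t)}\in\{2,3\}\ \forall t\in[k]\}$. Define $$\mathcal C_k=\Big\{\overline K_{[k]}\circ span\Big(\bigcup_{i\in[k]}(E_i\cup F_i)\Big): E_i\in\mathcal E(C^k_i,[3]^k_i(2)),\ F_i\in\mathcal E(D^k_i,S^k_i)\ \text{for each } i\in[k]\Big\}.$$ $H_2$ is called $k$-minimal if $\overline K_{[k]}\circ H_2\in\mathcal C_k$ and $\overline K_{[k]}\circ H_2'\notin\mathcal C_k$ for every spanning subgraph $H_2'\ne H_2$ of $H_2$ (same vertex set $[3]^k$, edge set properly contained in $E(H_2)$). *)

(* Defs.v *)
From HB Require Import structures.
From mathcomp Require Import all_boot all_algebra.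

Set Implicit Arguments.
Unset Strict Implicit.
Unset Printing Implicit Defensive.

(* A finite simple graph whose vertex set is a subset of an ambient finite
   type T; edges are 2-element sets of vertices.  The side condition is boolean,
   so two graphs are equal iff they have the same vertices and edges. *)
Definition is_graph (T : finType) (V : {set T}) (E : {set {set T}}) : bool :=
  [forall e in E, (#|e| == 2) && (e \subset V)].

Record graph (T : finType) := Graph {
  verts : {set T};
  edges : {set {set T}};
  graphP : is_graph verts edges }.

Lemma graph_ext (T : finType) (G H : graph T) :
  verts G = verts H -> edges G = edges H -> G = H.
Proof.
case: G H => V E hG [W F hH] /= eVW eEF.
by subst W F; rewrite (bool_irrelevance hG hH).
Qed.

Definition spanning_subgraph (T : finType) (G H : graph T) : Prop :=
  verts G = verts H /\ edges G \subset edges H.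

Definition coverings (T : finType) (F : graph T) (S : {set T}) :
  {set {set {set T}}} :=
  [set E : {set {set T}} |
    (E \subset edges F) && [forall v in S, exists e in E, v \in e]].

Section Bipartite.
Variables (T : finType) (A B : {set T}) (r : rel T).

Definition bipartite_edges : {set {set T}} :=
  [set [set x; y] | x in A, y in B & r x y].

Lemma bipartite_is_graph :
  [disjoint A & B] -> is_graph (A :|: B) bipartite_edges.
Proof.
move=> dAB; apply/forall_inP => e /imset2P[x y xA].
rewrite inE => /andP[yB _] ->; rewrite cards2 subUset !sub1set !inE xA yB orbT.
by rewrite !andbT; have [xy|//] := eqVneq x y; move: yB; rewrite -xy (disjointFr dAB xA).
Qed.

Definition bipartite (dAB : [disjoint A & B]) : graph T :=
  Graph (bipartite_is_graph dAB).

End Bipartite.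

(* [3]^k; the entry 'x i : 'I_3' is shifted by one, so that the coordinate
   'coord x i' takes the values 1, 2, 3.  Likewise [k] is 'I_k. *)
Notation cube k := {ffun 'I_k -> 'I_3}.

Definition coord (k : nat) (x : cube k) (i : 'I_k) : nat := (x i).+1.

Definition slice (k : nat) (i : 'I_k) (j : nat) : {set cube k} :=
  [set x : cube k | coord x i == j].

Lemma slice_disjoint (k : nat) (i : 'I_k) (j l : nat) :
  j != l -> [disjoint slice i j & slice i l].
Proof.
move=> njl; apply/pred0P => x /=; rewrite !inE.
by apply: contraNF njl => /andP[/eqP <- /eqP <-].
Qed.

Definition close_off (k : nat) (i : 'I_k) : rel (cube k) :=
  fun x y => [forall t : 'I_k, (t != i) ==>
                (`|coord x t - coord y t|%N <= 1)].

Definition graphC (k : nat) (i : 'I_k) : graph (cube k) :=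
  bipartite (close_off i) (slice_disjoint i (isT : 1 != 2)).

Definition graphD (k : nat) (i : 'I_k) : graph (cube k) :=
  bipartite (close_off i) (slice_disjoint i (isT : 2 != 3)).

Definition setS (k : nat) (i : 'I_k) : {set cube k} :=
  [set x : cube k | (coord x i == 3) &&
     [forall t : 'I_k, (coord x t == 2) || (coord x t == 3)]].

Section Composition.
Variables (k : nat) (H : graph (cube k)).

Definition compose_verts : {set 'I_k + cube k} :=
  [set inl i | i : 'I_k] :|: [set inr x | x in verts H].

Definition compose_edges : {set {set 'I_k + cube k}} :=
  [set [set inr x | x in e] | e : {set cube k} in edges H] :|:
  [set [set inl i; inr x] | i : 'I_k, x : cube k in verts H & coord x i == 1].

Lemma compose_is_graph : is_graph compose_verts compose_edges.
Proof.
apply/forall_inP => e /setUP[/imsetP[f fH ->]|/imset2P[i x _]].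
  have /andP[f2 fV] := forall_inP (graphP H) f fH.
  rewrite card_imset; last by move=> ? ? [].
  by rewrite f2 (subset_trans (imsetS _ fV)) // subsetUr.
rewrite inE => /andP[xV _] ->; rewrite cards2 subUset !sub1set /=.
by rewrite !inE imset_f //= [X in _ || X]imset_f ?orbT.
Qed.

(* The graph obtained from the edgeless graph on [k] and H, for H on [3]^k. *)
Definition compose : graph ('I_k + cube k)%type := Graph compose_is_graph.

End Composition.

(* The filter only makes span total: it is the identity on sets of 2-subsets
   (see edges_span), the only sets to which span is meant to be applied. *)
Lemma span_is_graph (k : nat) (E : {set {set cube k}}) :
  is_graph [set: cube k] [set e in E | #|e| == 2].
Proof. by apply/forall_inP => e; rewrite !inE subsetT => /andP[_ ->]. Qed.

Definition span (k : nat) (E : {set {set cube k}}) : graph (cube k) :=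
  Graph (span_is_graph E).

Lemma edges_span (k : nat) (E : {set {set cube k}}) :
  (forall e, e \in E -> #|e| = 2) -> edges (span E) = E.
Proof.
move=> hE; apply/setP => e; rewrite inE.
by case: (boolP (e \in E)) => // /hE ->.
Qed.

Definition calC (k : nat) (G : graph ('I_k + cube k)%type) : Prop :=
  exists E F : 'I_k -> {set {set cube k}},
    [/\ forall i, E i \in coverings (graphC i) (slice i 2),
        forall i, F i \in coverings (graphD i) (setS i)
      & G = compose (span (\bigcup_(i : 'I_k) (E i :|: F i)))].

Definition k_minimal (k : nat) (H : graph (cube k)) : Prop :=
  calC (compose H) /\
  forall H' : graph (cube k),
    spanning_subgraph H' H -> H' <> H -> ~ calC (compose H').

(* Main.v *)
(** Lower bound: an edge used to cover [y] at an index where [y] has a [2] has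
    its other end at a point with a [1].  Let [A] be the points without a [1]
    and [C] those without a [2].  Each of the [2 ^ k] points [y] of [A] has an
    edge through [y] that meets [A] only in [y]; the sole exception is the point
    with all entries [3], which lies on some edge.  So these [2 ^ k] edges are
    distinct.  The [3 ^ k - 2 ^ k.+1 + 1] points outside [A] and [C] lie on
    edges that avoid [A], and each of those accounts for at most two points.
    Hence at least [2 ^ k + (3 ^ k - 2 ^ k.+1 + 1) / 2] edges.

    Upper bound: in every covering keep one edge per point to be covered; by
    minimality nothing is lost. *)
Require Import Defs.
From mathcomp Require Import all_boot all_algebra.
From mathcomp Require Import zify.

Set Implicit Arguments.
Unset Strict Implicit.
Unset Printing Implicit Defensive.

Lemma coveringsP (T : finType) (F : graph T) (S : {set T})
    (E : {set {set T}}) :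
  reflect (E \subset edges F /\
           forall v, v \in S -> exists2 e, e \in E & v \in e)
          (E \in coverings F S).
Proof.
rewrite inE; apply: (iffP andP) => -[sE cE]; split=> //.
  by move=> v /(forall_inP cE)/exists_inP.
by apply/forall_inP => v /cE ?; apply/exists_inP.
Qed.

(** Choosing one covering edge per vertex of [S] gives a subcovering, the image of [S] under the
    choice. *)
Lemma small_covering (T : finType) (F : graph T) (S : {set T})
    (E : {set {set T}}) :
  E \in coverings F S ->
  exists E' : {set {set T}},
    [/\ E' \subset E, E' \in coverings F S & #|E'| <= #|S|].
Proof.
move=> /coveringsP[sEF cE].
have [g gP] : exists g : T -> {set T},
    forall v, v \in S -> g v \in E /\ v \in g v.
  apply: (@fin_all_exists _ _ (fun v e => v \in S -> e \in E /\ v \in e)) => v.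
  case: (boolP (v \in S)) => [/cE[e eE ve]|_].
    by exists e.
  (* Dummy value outside [S]; only [g @: S] is used. *)
  by exists set0.
have sgE : g @: S \subset E by apply/subsetP => _ /imsetP[v /gP[? _] ->].
exists (g @: S); split; rewrite ?leq_imset_card //.
apply/coveringsP; split; first exact: subset_trans sEF.
by move=> v vS; exists (g v); [exact: imset_f | case: (gP v vS)].
Qed.

(** An edge has only one end in [B], so in an edge covering [v] that end must be [v] itself. *)
Lemma bipartite_covering (T : finType) (A B S : {set T}) (r : rel T)
    (dAB : [disjoint A & B]) (E : {set {set T}}) v :
  E \in coverings (bipartite r dAB) S -> S \subset B -> v \in S ->
  exists2 x, x \in A & [set x; v] \in E.
Proof.
move=> /coveringsP[sE cE] sSB vS; have [e eE ve] := cE v vS.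
have /imset2P[x y xA] := subsetP sE e eE; rewrite inE => /andP[yB _] eq_e.
exists x => //; suff -> : v = y by rewrite -eq_e.
move: ve; rewrite eq_e => /set2P[vx|//].
by move: (subsetP sSB v vS); rewrite vx (disjointFr dAB xA).
Qed.

Lemma edge_card (T : finType) (G : graph T) (e : {set T}) : e \in edges G -> #|e| = 2.
Proof. by move=> /(forall_inP (graphP G))/andP[/eqP]. Qed.

(** Every edge that composition adds contains some [inl i], so the edges of [H] can be read off as
    those inside the [inr] side. *)
Lemma compose_edges_inj (k : nat) (H H' : graph (cube k)) :
  compose H = compose H' -> edges H = edges H'.
Proof.
suff sub (G G' : graph (cube k)) :
    compose G = compose G' -> edges G \subset edges G'.
  by move=> eqH; apply/eqP; rewrite eqEsubset !sub.
move=> eqG; apply/subsetP => e eG.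
have : inr @: e \in edges (compose G) by apply/setUP; left; exact: imset_f.
rewrite eqG => /setUP[/imsetP[f fG' ef]|/imset2P[i x _ _ ef]].
  by rewrite (imset_inj _ ef) // => ? ? [].
have : inl i \in inr @: e by rewrite ef set21.
by case/imsetP.
Qed.

Lemma card_cube_forall (k : nat) (P : 'I_k -> pred 'I_3) :
  #|[set x : cube k | [forall t, P t (x t)]]| = \prod_t #|P t|.
Proof.
rewrite -[RHS]big_enum -[RHS](big_map _ predT id) -foldrE -card_family cardsE.
by apply: eq_card => x; apply/forallP/familyP.
Qed.

Lemma card_I3_neq (a : 'I_3) : #|[pred b : 'I_3 | b != a]| = 2.
Proof. by have := cardC1 a; rewrite card_ord. Qed.

Lemma card_cube_neq (k : nat) (a : 'I_3) :
  #|[set x : cube k | [forall t, x t != a]]| = 2 ^ k.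
Proof.
rewrite (card_cube_forall (fun _ => [pred b | b != a])).
by under eq_bigr => t _ do rewrite card_I3_neq; rewrite prod_nat_const card_ord.
Qed.

Lemma card_cube_except (k m : nat) (i : 'I_k) (a : 'I_3) (P : pred 'I_3) :
  #|P| = m ->
  #|[set x : cube k | [forall t, if t == i then x t == a else P (x t)]]|
    = m ^ (k - 1).
Proof.
move=> cP.
have := card_cube_forall (fun t b => if t == i then b == a else P b) => ->.
rewrite (bigD1 i) //= eqxx card1 mul1n.
rewrite (eq_bigr (fun=> m)) => [|t /negbTE-> //].
by rewrite prod_nat_const cardC1 card_ord subn1.
Qed.

Lemma card_slice2 (k : nat) (i : 'I_k) : #|slice i 2| = 3 ^ (k - 1).
Proof.
(* Entries are shifted: [ord0], [inord 1] and [ord_max] stand for 1, 2 and 3. *)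
rewrite -(@card_cube_except k 3 i (inord 1) predT) ?card_ord //.
apply: eq_card => x; rewrite !inE /Defs.coord.
have -> : ((x i).+1 == 2) = (x i == inord 1).
  by rewrite -val_eqE /= inordK.
apply/idP/forallP => [xi t|/(_ i)]; last by rewrite eqxx.
by case: (t =P i) => [->|].
Qed.

Lemma card_setS (k : nat) (i : 'I_k) : #|setS i| = 2 ^ (k - 1).
Proof.
rewrite -(@card_cube_except k 2 i ord_max (fun b => b != ord0)) ?card_I3_neq //.
apply: eq_card => x; rewrite !inE /Defs.coord.
have P2 (b : 'I_3) : (b.+1 == 3) = (b == ord_max) by [].
have P0 (b : 'I_3) : (b.+1 == 2) || (b.+1 == 3) = (b != ord0).
  by case: b => [[|[|[]]]].
rewrite P2; apply/andP/forallP => [[xi /forallP xP] t|xP].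
  by case: (t =P i) => [->//|_]; rewrite -P0; exact: xP.
split; first by have := xP i; rewrite eqxx.
apply/forallP => t; rewrite P0.
by have := xP t; case: (t =P i) => // _ /eqP ->.
Qed.

Lemma minimal_edges_le (k : nat) (H2 : graph (cube k)) :
  verts H2 = [set: cube k] -> k_minimal H2 ->
  #|edges H2| <= k * (3 ^ (k - 1) + 2 ^ (k - 1)).
Proof.
move=> hV [[E [F [cE cF eqH]]] minH].
have [E' E'P] := fin_all_exists (fun i => small_covering (cE i)).
have [F' F'P] := fin_all_exists (fun i => small_covering (cF i)).
set U := \bigcup_i (E i :|: F i) in eqH.
set U' := \bigcup_i (E' i :|: F' i).
have sU : U' \subset U.
  apply/bigcupsP => i _; apply: subset_trans (bigcup_sup i _) => //.
  by apply: setUSS; [case: (E'P i) | case: (F'P i)].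
have eqHspan : H2 = Defs.span U'.
  case: (eqVneq (edges H2) (edges (Defs.span U'))) => [|neq].
    exact: graph_ext.
  (* Otherwise [span U'] would be a proper spanning subgraph of [H2] whose composition lies in
     [calC], witnessed by [E'] and [F']. *)
  case: (minH (Defs.span U')); last 1 first.
  - exists E', F'; split=> // i; [by case: (E'P i) | by case: (F'P i)].
  - split; first by rewrite hV.
    rewrite (compose_edges_inj eqH); apply/subsetP => e; rewrite !inE.
    by move=> /andP[/(subsetP sU) -> ->].
  - by move=> eqs; rewrite eqs eqxx in neq.
rewrite eqHspan; apply: (@leq_trans #|U'|).
  by apply/subset_leq_card/subsetP => e; rewrite inE => /andP[].
apply: (@leq_trans (\sum_(i < k) #|E' i :|: F' i|)).
  apply: (big_ind2 (fun (P : {set {set cube k}}) n => #|P| <= n)) => //.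
    by rewrite cards0.
  by move=> P m Q n ? ?; rewrite (leq_trans (leq_card_setU _ _)) ?leq_add.
have -> : k * (3 ^ (k - 1) + 2 ^ (k - 1))
    = \sum_(i < k) (3 ^ (k - 1) + 2 ^ (k - 1)).
  by rewrite sum_nat_const card_ord.
apply: leq_sum => i _.
rewrite (leq_trans (leq_card_setU _ _)) // leq_add //.
  by rewrite -(card_slice2 i); case: (E'P i).
by rewrite -(card_setS i); case: (F'P i).
Qed.

(** The edges chosen for [A] meet [A] and those chosen for [B] do not, so the two images are
    disjoint. The first has [#|A|] members; the second covers [B] by 2-sets, so it has at least half
    of [#|B|]. *)
Lemma edges_ge_disjoint_system (T : finType) (E : {set {set T}}) (A B : {set T})
    (e : T -> {set T}) :
  (forall f, f \in E -> #|f| = 2) ->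
  (forall y, y \in A :|: B -> e y \in E /\ y \in e y) ->
  {in A &, injective e} ->
  (forall y, y \in B -> [disjoint e y & A]) ->
  2 * #|A| + #|B| <= 2 * #|E|.
Proof.
move=> E2 eP inj_e eB.
have dAB : [disjoint e @: A & e @: B].
  apply/pred0P => f /=; apply/andP => -[/imsetP[y yA ->] /imsetP[z zB eqe]].
  have [_ ye] := eP y (subsetP (subsetUl _ _) y yA).
  by move: (eB z zB); rewrite -eqe => /disjointFr/(_ ye); rewrite yA.
have sE : e @: A :|: e @: B \subset E.
  rewrite -imsetU; apply/subsetP => _ /imsetP[y yAB ->].
  by case: (eP y yAB).
have cB : #|B| <= 2 * #|e @: B|.
  apply: leq_trans (_ : #|cover (e @: B)| <= _).
    apply/subset_leq_card/subsetP => y yB.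
    apply/bigcupP; exists (e y); first exact: imset_f.
    by have [] := eP y (subsetP (subsetUr _ _) y yB).
  apply: leq_trans (leq_card_cover _) _.
  rewrite (eq_bigr (fun=> 2)) ?sum_nat_const ?(mulnC 2) // => f feB.
  by apply/E2/(subsetP sE); rewrite inE feB orbT.
have := subset_leq_card sE; rewrite cardsU (disjoint_setI0 dAB) cards0 subn0.
rewrite card_in_imset // => leE; apply: leq_trans (leq_mul (leqnn 2) leE).
by rewrite mulnDr leq_add2l.
Qed.

Lemma calC_edges_ge (k : nat) (H : graph (cube k)) :
  0 < k -> calC (compose H) -> 3 ^ k + 1 <= 2 * #|edges H|.
Proof.
move=> k0 [E [F [cE cF eqH]]].
have inH i e : e \in E i :|: F i -> e \in edges H.
  move=> ei; rewrite (compose_edges_inj eqH) edges_span.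
    by apply/bigcupP; exists i.
  move=> f /bigcupP[j _ /setUP[fj|fj]].
    by have /coveringsP[/subsetP/(_ f fj)/edge_card] := cE j.
  by have /coveringsP[/subsetP/(_ f fj)/edge_card] := cF j.
pose A := [set x : cube k | [forall t, x t != ord0]].
pose C := [set x : cube k | [forall t, x t != inord 1]].
pose top : cube k := [ffun=> ord_max].
have AC : A :&: C = [set top].
  apply/setP => x; rewrite !inE; apply/andP/eqP => [[/forallP xA /forallP xC]|->].
    apply/ffunP => t; rewrite ffunE; move: (xA t) (xC t).
    rewrite -!val_eqE /= inordK // => x0 x1; apply/val_inj => /=.
    by case: (x t) x0 x1 => [[|[|[]]]].
  by split; apply/forallP => t; rewrite ffunE -val_eqE /= ?inordK.
(* If [y] has a 2 at [i], then [E i] joins it to a point with a 1 at [i]. *)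
have E2 y : y \notin C -> exists2 x, x \notin A & [set x; y] \in edges H.
  rewrite inE => /forallPn[i]; rewrite negbK => /eqP yi.
  have yS : y \in slice i 2 by rewrite inE /Defs.coord yi inordK.
  have [x x1 xE] := bipartite_covering (cE i) (subxx _) yS.
  exists x; last by apply: (inH i); rewrite inE xE.
  rewrite inE; apply/forallPn; exists i; rewrite negbK -val_eqE /=.
  by move: x1; rewrite inE /Defs.coord => /eqP[->].
(* [top] lies in every [setS i], so [F i] covers it; [k0] supplies an index. *)
have Etop : exists2 e, e \in edges H & top \in e.
  pose i := Ordinal k0.
  have /coveringsP[_ /(_ top)] := cF i; case.
    by rewrite inE /Defs.coord ffunE; apply/forallP => t; rewrite ffunE.
  by move=> e eF te; exists e => //; apply: (inH i); rewrite inE eF orbT.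
(* The last clause serves both parts: it yields injectivity on [A], and disjointness from [A] for
   points outside [A]. *)
have [e eP] : exists e : cube k -> {set cube k}, forall y,
    y \in A :|: ~: (A :|: C) ->
    [/\ e y \in edges H, y \in e y & y != top -> e y :&: A \subset [set y]].
  apply: (@fin_all_exists _ _ (fun y f => y \in A :|: ~: (A :|: C) ->
    [/\ f \in edges H, y \in f & y != top -> f :&: A \subset [set y]])) => y.
  have [->|ytop] := eqVneq y top.
    by have [e] := Etop; exists e.
  have [yC|yC] := boolP (y \in C).
    have yA : y \notin A.
      apply: contraNN ytop => yA; rewrite -in_set1 -AC inE yA; exact: yC.
    by exists set0; rewrite !in_setU in_setC in_setU yC orbT (negbTE yA).
  have [x xA xyH] := E2 y yC; exists [set x; y]; split; rewrite ?set22 // => _.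
  apply/subsetP => z; rewrite in_setI => /andP[/set2P[->|->] zA].
    by rewrite zA in xA.
  by rewrite set11.
have key : 2 * #|A| + #|~: (A :|: C)| <= 2 * #|edges H|.
  apply: (@edges_ge_disjoint_system _ _ _ _ e) => [f|y|y z yA zA eyz|y yB].
  - exact: edge_card.
  - by case/eP.
  - have [_ ye yU] := eP y (subsetP (subsetUl _ _) y yA).
    have [_ ze zU] := eP z (subsetP (subsetUl _ _) z zA).
    (* If one of [y], [z] is not [top], the common edge meets [A] only in that point, which forces
       equality. *)
    have [ytop|/yU/subsetP/(_ z)] := eqVneq y top; last first.
      by rewrite inE eyz ze zA => /(_ isT)/set1P.
    have [->//|/zU/subsetP/(_ y)] := eqVneq z top.
    by rewrite inE -eyz ye yA => /(_ isT)/set1P.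
  - have [_ _ yU] := eP y (subsetP (subsetUr _ _) y yB).
    move: yB; rewrite in_setC in_setU negb_or => /andP[yA yC].
    have ytop : y != top.
      by apply: contraNneq yA => ->; have := set11 top; rewrite -AC => /setIP[].
    rewrite -setI_eq0 -subset0; apply/subsetP => z zI.
    move/subsetP/(_ z zI): (yU ytop) => /set1P zy; move: zI.
    by rewrite zy inE (negbTE yA) andbF.
(* [cT], and later [2 ^ k > 0], keep the subtractions from truncating. *)
have cU := cardsCs (A :|: C); have cT := max_card (mem (~: (A :|: C))).
move: key cU cT; rewrite cardsU AC cards1 !card_cube_neq.
rewrite card_ffun !card_ord.
have := expn_gt0 2 k; lia.
Qed.

(* The division is exact, 3 ^ k + 1 being even. *)
Theorem theorem4p18 (k : nat) (hk : 2 <= k) (H2 : graph (cube k))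
    (hV : verts H2 = [set: cube k]) (hmin : k_minimal H2) :
  (3 ^ k + 1) %/ 2 <= #|edges H2| /\
  #|edges H2| <= k * (3 ^ (k - 1) + 2 ^ (k - 1)).
Proof.
split; last exact: minimal_edges_le.
have := calC_edges_ge (ltnW hk) hmin.1; lia.
Qed.
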